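(* Let $k$ be a field, $P=k[[x_1,\dots,x_n]]$, $\widetilde R=k[[t_1]]\oplus\dots\oplus k[[t_r]]$, and let $\varphi:P\to\widetilde R$ be a parameterization. If $\delta_\varphi<\infty$, where $\delta_\varphi=\dim_k\widetilde R/\varphi(P)$, then $\varphi$ is $(4\delta_\varphi-2)$-$\mathcal L$-determined.
   Context: Let $k$ be an arbitrary field, $P=k[[x_1,\dots,x_n]]$, $\widetilde R=k[[t_1]]\oplus\dots\oplus k[[t_r]]$ with Jacobson radical $\widetilde{\mathfrak m}=t_1k[[t_1]]\oplus\dots\oplus t_rk[[t_r]]$. A parameterization (of the curve singularity $\varphi(P)$ with $r$ branches) is a morphism of $k$-algebras $\varphi:P\to\widetilde R$ with $\varphi(x_i)\in\widetilde{\mathfrak m}$ for all $i$ such that, with $\varphi_j:P\to k[[t_j]]$ the $j$-th component of $\varphi$: for each $j$ there is at least one $i$ with $\varphi_j(x_i)\ne0$, and $\operatorname{Ker}(\varphi_j)\ne\operatorname{Ker}(\varphi_{j'})$ for $j\ne j'$ (the branches are pairwise distinct). Two parameterizations $\varphi,\psi:P\to\widetilde R$ are left equivalent ($\mathcal L$-equivalent) if there is a $k$-algebra automorphism $\sigma$ of $P$ with $\varphi\circ\sigma^{-1}=\psi$. For an integer $m$, $\varphi$ is called $m$-$\mathcal L$-determined if every parameterization $\psi:P\to\widetilde R$ with $\varphi(x_i)\equiv\psi(x_i)\bmod\widetilde{\mathfrak m}^{m+1}$ for all $i$ is $\mathcal L$-equivalent to $\varphi$.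
   Formalization: The case r = 1 with δ_φ ≤ 1 is excluded (r > 1 or δ_φ > 1 is assumed), since the claim fails there: (t²,t³) and (t²,t⁵) agree mod t³ but are not left equivalent, although δ = 1 for the first. *)

(* Defs.v *)
From HB Require Import structures.
From mathcomp Require Import all_boot all_order all_algebra.
From mathcomp Require Import boolp mpoly.

Set Implicit Arguments.
Unset Strict Implicit.
Unset Printing Implicit Defensive.

Import GRing.Theory.
Local Open Scope ring_scope.

(* [{fps R}] is R[[t]]. *)

Record fps (R : Type) : Type := Fps { fps_coef : nat -> R }.

Notation "{ 'fps' R }" := (fps R)
  (at level 0, R at level 2, format "{ 'fps'  R }") : type_scope.

HB.instance Definition _ (R : Type) := gen_eqMixin {fps R}.
HB.instance Definition _ (R : Type) := gen_choiceMixin {fps R}.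

Lemma fpsP (R : Type) (f g : {fps R}) :
  (forall i, fps_coef f i = fps_coef g i) <-> f = g.
Proof.
split=> [|-> //]; case: f g => [f] [g] /= fg; congr Fps.
by apply: funext.
Qed.

Section FpsZmod.
Variable R : zmodType.
Implicit Types f g h : {fps R}.

Definition fps_zero : {fps R} := Fps (fun=> 0).
Definition fps_add f g := Fps (fun i => fps_coef f i + fps_coef g i).
Definition fps_opp f := Fps (fun i => - fps_coef f i).

Fact fps_addA : associative fps_add.
Proof. by move=> f g h; apply/fpsP=> i /=; rewrite addrA. Qed.
Fact fps_addC : commutative fps_add.
Proof. by move=> f g; apply/fpsP=> i /=; rewrite addrC. Qed.
Fact fps_add0 : left_id fps_zero fps_add.
Proof. by move=> f; apply/fpsP=> i /=; rewrite add0r. Qed.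
Fact fps_addN : left_inverse fps_zero fps_opp fps_add.
Proof. by move=> f; apply/fpsP=> i /=; rewrite addNr. Qed.

HB.instance Definition _ :=
  Algebra.isZmodule.Build {fps R} fps_addA fps_addC fps_add0 fps_addN.

End FpsZmod.

Section FpsRing.
Variable R : comNzRingType.
Implicit Types f g h : {fps R}.

Definition fps_one : {fps R} := Fps (fun i => (i == 0)%:R).
Definition fps_mul f g : {fps R} :=
  Fps (fun i => \sum_(j < i.+1) fps_coef f j * fps_coef g (i - j)).
Definition fps_scale (a : R) f : {fps R} := Fps (fun i => a * fps_coef f i).

Let tr d f : {poly R} := \poly_(i < d) fps_coef f i.

Let fps_mulE d f g i : (i < d)%N -> fps_coef (fps_mul f g) i = (tr d f * tr d g)`_i.
Proof.
move=> id; rewrite coefM; apply: eq_bigr => -[j /= ji] _.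
rewrite !coef_poly (leq_ltn_trans (leq_subr j i) id).
by rewrite (leq_ltn_trans (ji : (j <= i)%N) id).
Qed.

Fact fps_mulA : associative fps_mul.
Proof.
move=> f g h; apply/fpsP=> i.
transitivity ((tr i.+1 f * (tr i.+1 g * tr i.+1 h))`_i).
  rewrite (fps_mulE _ _ (ltnSn i)) !coefM; apply: eq_bigr => -[j /= ji] _.
  by rewrite [(tr _ (fps_mul _ _))`_(i - j)]coef_poly ltnS leq_subr (@fps_mulE i.+1)
    // ltnS leq_subr.
rewrite mulrA (fps_mulE _ _ (ltnSn i)) !coefM; apply: eq_bigr => -[j /= ji] _.
by rewrite [(tr _ (fps_mul _ _))`_j]coef_poly ji (@fps_mulE i.+1).
Qed.

Fact fps_mulC : commutative fps_mul.
Proof.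
by move=> f g; apply/fpsP=> i; rewrite !(fps_mulE _ _ (ltnSn i)) mulrC.
Qed.

Fact fps_mul1 : left_id fps_one fps_mul.
Proof.
move=> f; apply/fpsP=> i /=.
rewrite big_ord_recl /= mul1r subn0 big1 ?addr0 // => j _.
by rewrite mul0r.
Qed.

Fact fps_mulDl : left_distributive fps_mul +%R.
Proof.
move=> f g h; apply/fpsP=> i /=; rewrite -big_split /=.
by apply: eq_bigr => j _; rewrite mulrDl.
Qed.

Fact fps_one_neq0 : fps_one != 0.
Proof.
by apply/eqP=> /fpsP/(_ 0%N)/eqP; rewrite /= oner_eq0.
Qed.

HB.instance Definition _ :=
  GRing.Zmodule_isComNzRing.Build {fps R}
    fps_mulA fps_mulC fps_mul1 fps_mulDl fps_one_neq0.

Fact fps_scaleA a b f : fps_scale a (fps_scale b f) = fps_scale (a * b) f.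
Proof. by apply/fpsP=> i /=; rewrite mulrA. Qed.
Fact fps_scale1 : left_id 1 fps_scale.
Proof. by move=> f; apply/fpsP=> i /=; rewrite mul1r. Qed.
Fact fps_scaleDr : right_distributive fps_scale +%R.
Proof. by move=> a f g; apply/fpsP=> i /=; rewrite mulrDr. Qed.
Fact fps_scaleDl f : {morph fps_scale^~ f : a b / a + b}.
Proof. by move=> a b; apply/fpsP=> i /=; rewrite mulrDl. Qed.

HB.instance Definition _ :=
  GRing.Zmodule_isLmodule.Build R {fps R}
    fps_scaleA fps_scale1 fps_scaleDr fps_scaleDl.

Fact fps_scaleAl (a : R) (f g : {fps R}) : a *: (f * g) = (a *: f) * g.
Proof.
apply/fpsP=> i; rewrite /= mulr_sumr; apply: eq_bigr => j _.
by rewrite mulrA.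
Qed.

HB.instance Definition _ :=
  GRing.Lmodule_isLalgebra.Build R {fps R} fps_scaleAl.
HB.instance Definition _ := GRing.Lalgebra_isComAlgebra.Build R {fps R}.

Definition fpsX : {fps R} := Fps (fun i => (i == 1)%:R).

End FpsRing.

Arguments fpsX {R}.

(* [{mps R[n]}] is R[[x_1, ..., x_n]]. *)

Record mps (R : Type) (n : nat) : Type := Mps { mps_coef : 'X_{1..n} -> R }.

Notation "{ 'mps' R [ n ] }" := (mps R n)
  (at level 0, R at level 2, n at level 2, format "{ 'mps'  R [ n ] }")
  : type_scope.

HB.instance Definition _ (R : Type) n := gen_eqMixin {mps R[n]}.
HB.instance Definition _ (R : Type) n := gen_choiceMixin {mps R[n]}.

Lemma mpsP (R : Type) n (f g : {mps R[n]}) :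
  (forall m, mps_coef f m = mps_coef g m) <-> f = g.
Proof.
split=> [|-> //]; case: f g => [f] [g] /= fg; congr Mps.
by apply: funext.
Qed.

Section MpsZmod.
Variables (R : zmodType) (n : nat).
Implicit Types f g h : {mps R[n]}.

Definition mps_zero : {mps R[n]} := Mps (fun=> 0).
Definition mps_add f g := Mps (fun m => mps_coef f m + mps_coef g m).
Definition mps_opp f := Mps (fun m => - mps_coef f m).

Fact mps_addA : associative mps_add.
Proof. by move=> f g h; apply/mpsP=> i /=; rewrite addrA. Qed.
Fact mps_addC : commutative mps_add.
Proof. by move=> f g; apply/mpsP=> i /=; rewrite addrC. Qed.
Fact mps_add0 : left_id mps_zero mps_add.
Proof. by move=> f; apply/mpsP=> i /=; rewrite add0r. Qed.
Fact mps_addN : left_inverse mps_zero mps_opp mps_add.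
Proof. by move=> f; apply/mpsP=> i /=; rewrite addNr. Qed.

HB.instance Definition _ :=
  Algebra.isZmodule.Build {mps R[n]} mps_addA mps_addC mps_add0 mps_addN.

End MpsZmod.

Section MpsRing.
Variables (R : comNzRingType) (n : nat).
Implicit Types f g h : {mps R[n]}.

Definition mps_one : {mps R[n]} := Mps (fun m => (m == 0%MM)%:R).
(* The degree bounds only make the index type finite: [m = m1 + m2] forces
   both degrees to be at most [mdeg m]. *)
Definition mps_mul f g : {mps R[n]} :=
  Mps (fun m => \sum_(h : 'X_{1..n < (mdeg m).+1, (mdeg m).+1}
                      | m == (h.1 + h.2)%MM) mps_coef f h.1 * mps_coef g h.2).
Definition mps_scale (a : R) f : {mps R[n]} := Mps (fun m => a * mps_coef f m).

Let tr d f : {mpoly R[n]} := \sum_(m : 'X_{1..n < d}) mps_coef f m *: 'X_[m].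

Let coef_tr d f m : (mdeg m < d)%N -> (tr d f)@_m = mps_coef f m.
Proof.
move=> md; rewrite /tr raddf_sum /= (bigD1 (BMultinom md)) //=.
rewrite mcoeffZ mcoeffX eqxx mulr1 big1 ?addr0 // => m' ne.
rewrite mcoeffZ mcoeffX; case: eqP => [e|_]; last by rewrite mulr0.
by case/eqP: ne; apply: val_inj.
Qed.

Let mps_mulE d f g m : (mdeg m < d)%N ->
  mps_coef (mps_mul f g) m = (tr d f * tr d g)@_m.
Proof.
move=> md; rewrite mcoeffM; apply: eq_bigr => -[[m1 d1] [m2 d2]] /= _.
by rewrite !coef_tr ?(leq_trans d1) ?(leq_trans d2).
Qed.

Fact mps_mulA : associative mps_mul.
Proof.
move=> f g h; apply/mpsP=> m; pose d := (mdeg m).+1.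
transitivity ((tr d f * (tr d g * tr d h))@_m).
  rewrite (@mps_mulE d) // !mcoeffM; apply: eq_bigr => -[[m1 d1] [m2 d2]] /= _.
  by rewrite [(tr d (mps_mul _ _))@_m2]coef_tr // (@mps_mulE d).
rewrite mulrA (@mps_mulE d) // !mcoeffM.
apply: eq_bigr => -[[m1 d1] [m2 d2]] /= _.
by rewrite [(tr d (mps_mul _ _))@_m1]coef_tr // (@mps_mulE d).
Qed.

Fact mps_mulC : commutative mps_mul.
Proof.
by move=> f g; apply/mpsP=> m; rewrite !(mps_mulE _ _ (ltnSn _)) mulrC.
Qed.

Fact mps_mul1 : left_id mps_one mps_mul.
Proof.
move=> f; apply/mpsP=> m; pose d := (mdeg m).+1.
rewrite (@mps_mulE d) //; have -> : tr d mps_one = 1; last first.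
  by rewrite mul1r coef_tr.
rewrite /tr (bigD1 (BMultinom (bm0_proof n (mdeg m)))) //= eqxx scale1r mpolyX0.
rewrite big1 ?addr0 // => m' ne; case: eqP => [e|_]; last by rewrite scale0r.
by case/eqP: ne; apply: val_inj.
Qed.

Fact mps_mulDl : left_distributive mps_mul +%R.
Proof.
move=> f g h; apply/mpsP=> m /=; rewrite -big_split /=.
by apply: eq_bigr => j _; rewrite mulrDl.
Qed.

Fact mps_one_neq0 : mps_one != 0.
Proof.
by apply/eqP=> /mpsP/(_ 0%MM)/eqP; rewrite /= eqxx oner_eq0.
Qed.

HB.instance Definition _ :=
  GRing.Zmodule_isComNzRing.Build {mps R[n]}
    mps_mulA mps_mulC mps_mul1 mps_mulDl mps_one_neq0.

Fact mps_scaleA a b f : mps_scale a (mps_scale b f) = mps_scale (a * b) f.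
Proof. by apply/mpsP=> i /=; rewrite mulrA. Qed.
Fact mps_scale1 : left_id 1 mps_scale.
Proof. by move=> f; apply/mpsP=> i /=; rewrite mul1r. Qed.
Fact mps_scaleDr : right_distributive mps_scale +%R.
Proof. by move=> a f g; apply/mpsP=> i /=; rewrite mulrDr. Qed.
Fact mps_scaleDl f : {morph mps_scale^~ f : a b / a + b}.
Proof. by move=> a b; apply/mpsP=> i /=; rewrite mulrDl. Qed.

HB.instance Definition _ :=
  GRing.Zmodule_isLmodule.Build R {mps R[n]}
    mps_scaleA mps_scale1 mps_scaleDr mps_scaleDl.

Fact mps_scaleAl (a : R) (f g : {mps R[n]}) : a *: (f * g) = (a *: f) * g.
Proof.
apply/mpsP=> i; rewrite /= mulr_sumr; apply: eq_bigr => j _.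
by rewrite mulrA.
Qed.

HB.instance Definition _ :=
  GRing.Lmodule_isLalgebra.Build R {mps R[n]} mps_scaleAl.
HB.instance Definition _ := GRing.Lalgebra_isComAlgebra.Build R {mps R[n]}.

Definition mpsX (i : 'I_n) : {mps R[n]} := Mps (fun m => (m == U_(i)%MM)%:R).

End MpsRing.

Arguments mpsX {R n} i.

(* I^s, with I^0 the whole ring; meant for ideals I of a commutative ring. *)
Definition ideal_pow (A : pzRingType) (I : A -> Prop) (s : nat) (a : A) : Prop :=
  exists (N : nat) (c : 'I_N -> A) (g : 'I_N -> 'I_s -> A),
    (forall l i, I (g l i)) /\ a = \sum_l c l * \prod_i g l i.

(* dim_k V/U = d, for a linear subspace U of V: the classes of the [b i] are a
   basis of V/U. *)
Definition dim_quotient (k : fieldType) (V : lmodType k) (U : V -> Prop)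
    (d : nat) : Prop :=
  exists b : 'I_d -> V, forall v : V,
    exists! c : {ffun 'I_d -> k}, U (v - \sum_i c i *: b i).

(* A finite function carries the pointwise k-algebra operations, so this is the
   product of r copies of k[[t]]. *)
Notation Rtilde k r := {ffun 'I_r -> {fps k}}.

Section Parameterization.
Variables (k : fieldType) (n r : nat).

Definition mtilde (f : Rtilde k r) : Prop :=
  forall j, exists g : {fps k}, f j = fpsX * g.

Implicit Types phi psi : {lrmorphism {mps k[n]} -> Rtilde k r}.

Definition parameterization phi : Prop :=
  [/\ forall i, mtilde (phi (mpsX i)),
      forall j, exists i, phi (mpsX i) j != 0
    & forall j j', j != j' ->
        ~ (forall f, phi f j = 0 <-> phi f j' = 0)].

Definition delta_invariant phi (d : nat) : Prop :=
  dim_quotient (fun v : Rtilde k r => exists f, phi f = v) d.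

Definition L_equivalent phi psi : Prop :=
  exists sigma sigmaV : {lrmorphism {mps k[n]} -> {mps k[n]}},
    [/\ cancel sigma sigmaV, cancel sigmaV sigma & phi \o sigmaV =1 psi].

Definition L_determined (m : nat) phi : Prop :=
  forall psi, parameterization psi ->
    (forall i, ideal_pow mtilde m.+1 (phi (mpsX i) - psi (mpsX i))) ->
    L_equivalent phi psi.

End Parameterization.

(* Main.v *)
Require Import Defs.
From HB Require Import structures.
From mathcomp Require Import all_boot all_order all_algebra.
From mathcomp Require Import boolp mpoly.
From mathcomp Require Import zify ring.
Import GRing.Theory.
Local Open Scope ring_scope.

(** Let R be the image of phi, of codimension delta, and let psi be a
    parameterization with psi(x_i) - phi(x_i) of order at least 4 delta - 1 on
    every branch. It suffices to find g_i of order at least 2 in P with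
    phi(g_i) = psi(x_i) - phi(x_i). Indeed the substitution s : x_i -> x_i + g_i
    is then an automorphism of P, because s(f) - f always has larger order than
    f ([perturbation_inverse]), and phi o s and psi agree on the variables,
    hence everywhere ([lrmorphism_ext]).

    The g_i come from two facts about a branch j.

    - The conductor: a tuple concentrated on branch j and of order at least
      2 delta there lies in R ([conductor_2delta]). The series f such that f
      placed on branch j lies in R form a nonunital subalgebra A_j of k[[t]] of
      codimension at most delta. Call s a gap if no element of A_j has order s.
      There are at most delta gaps ([card_gaps_le]). Orders add under
      multiplication, so if s is a gap then each pair (a, s - a) contains a gap;
      thus s + 1 <= 2 delta. To pass from orders to the ideal t^(2 delta) k[[t]]
      one needs that A_j contains some t^N k[[t]]. It does, since R contains an f
      with nonzero j-th component that multiplies a complement of R into R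
      ([conductor_ex]): this is finitely many linear conditions on combinations
      of the powers of an element of R.

    - The multiplicity: some x_i has order e with 0 < e < 2 delta on branch j
      ([small_order]). Otherwise the j-th components of R would be constant
      modulo a high power of t, and too many powers of t on branch j would be
      independent modulo R.

    Hence an element of order at least 4 delta - 1 on branch j is phi(x_i) times
    one of order at least 2 delta, and the latter is phi(p) with p(0) = 0. So
    x_i p is a lift of order at least 2 ([lift_order_2]). *)

Set Implicit Arguments.
Unset Strict Implicit.
Unset Printing Implicit Defensive.

(** * A fixed-point principle *)

(** Iteration fixes one more degree at each step. This solves equations between
    power series, in one or several variables, coefficient by coefficient. *)
Lemma contraction_fixpoint (X T : Type) (deg : X -> nat)
    (F : (X -> T) -> X -> T) (f0 : X -> T) :
  (forall d f g, (forall x, (deg x < d)%N -> f x = g x) ->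
     forall x, (deg x < d.+1)%N -> F f x = F g x) ->
  exists f, forall x, F f x = f x.
Proof.
move=> contrF.
have stable d e x : (deg x < d)%N -> iter (d + e) F f0 x = iter d F f0 x.
  elim: d x => [//|d IHd] x xd; rewrite addSn !iterS.
  exact: (contrF d).
exists (fun x => iter (deg x).+1 F f0 x) => x.
rewrite /=; apply: (contrF (deg x)) => // y yx.
by rewrite -(subnKC yx) stable.
Qed.

(** * Orders of one-variable power series *)

Definition fps_ord_ge (k : fieldType) (d : nat) (f : {fps k}) : Prop :=
  forall i, (i < d)%N -> fps_coef f i = 0.

Section FpsOrder.
Variable k : fieldType.
Implicit Types f g : {fps k}.

Lemma fps_coef_sum I (s : seq I) (P : pred I) (F : I -> {fps k}) i :
  fps_coef (\sum_(l <- s | P l) F l) i = \sum_(l <- s | P l) fps_coef (F l) i.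
Proof. by apply: (big_morph (fun f => fps_coef f i)). Qed.

Lemma fps_coefXM f i : fps_coef (fpsX * f) i = if i is i'.+1 then fps_coef f i' else 0.
Proof.
rewrite /= big_ord_recl /= mul0r add0r.
case: i => [|i]; first by rewrite big_ord0.
rewrite big_ord_recl /= mul1r subSS subn0 big1 ?addr0 // => j _.
by rewrite mul0r.
Qed.

Lemma fps_coefXnM d f i :
  fps_coef (fpsX ^+ d * f) i = if (i < d)%N then 0 else fps_coef f (i - d).
Proof.
elim: d i => [|d IHd] i; first by rewrite expr0 mul1r subn0.
rewrite exprS -mulrA fps_coefXM; case: i => [//|i].
by rewrite IHd ltnS subSS.
Qed.

Lemma fps_ord_geP d f : fps_ord_ge d f <-> exists g, f = fpsX ^+ d * g.
Proof.
split=> [fd|[g ->] i id]; last by rewrite fps_coefXnM id.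
exists (Fps (fun i => fps_coef f (i + d))); apply/fpsP=> i.
rewrite fps_coefXnM; case: ltnP => [/fd //|di] /=.
by rewrite subnK.
Qed.

Lemma fps_ord_ge_sum d I (s : seq I) (P : pred I) (F : I -> {fps k}) :
  (forall l, P l -> fps_ord_ge d (F l)) -> fps_ord_ge d (\sum_(l <- s | P l) F l).
Proof.
by move=> Fd i id; rewrite fps_coef_sum big1 // => l Pl; apply: Fd.
Qed.

Lemma fps_ord_geM a b f g :
  fps_ord_ge a f -> fps_ord_ge b g -> fps_ord_ge (a + b) (f * g).
Proof.
move=> fa gb i iab /=; apply: big1 => j _.
case: (ltnP j a) => ja; first by rewrite fa ?mul0r.
by rewrite gb ?mulr0 //; move: (ltn_ord j); lia.
Qed.

Lemma fps_ord_ge_prod s (F : 'I_s -> {fps k}) :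
  (forall l, fps_ord_ge 1 (F l)) -> fps_ord_ge s (\prod_l F l).
Proof.
elim: s F => [|s IHs] F F1; first by [].
by rewrite big_ord_recl; apply: (@fps_ord_geM 1 s) => //; apply: IHs.
Qed.

Lemma fps_coefM_lead a b f g : fps_ord_ge a f -> fps_ord_ge b g ->
  fps_coef (f * g) (a + b) = fps_coef f a * fps_coef g b.
Proof.
move=> fa gb /=; have aab : (a < (a + b).+1)%N by lia.
rewrite (bigD1 (Ordinal aab)) //= addKn big1 ?addr0 // => -[j /= jab].
rewrite -val_eqE /= => ja.
case: (ltnP j a) => ja'; first by rewrite fa ?mul0r.
by rewrite gb ?mulr0 //; lia.
Qed.

Lemma fps_ord_ex f : f != 0 -> exists2 a, fps_ord_ge a f & fps_coef f a != 0.
Proof.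
move=> f0; have [i fi] : exists i, fps_coef f i != 0.
  apply: contrapT => nf; case/eqP: f0; apply/fpsP => i /=.
  by apply: contrapT => fi; apply: nf; exists i; apply/eqP.
case: (ex_minnP (ex_intro (fun i => fps_coef f i != 0) i fi)) => a fa min_a.
exists a => // j ja; apply/eqP; case: eqP => // /eqP /min_a.
by rewrite leqNgt ja.
Qed.

(** An element of order a generates the ideal (t^a). *)
Lemma fps_divX a f w : fps_ord_ge a f -> fps_coef f a != 0 ->
  exists g, f * g = fpsX ^+ a * w.
Proof.
move=> /fps_ord_geP[u ->{f}]; rewrite fps_coefXnM ltnn subnn => u0.
suff [g ug] : exists g, u * g = w by exists g; rewrite -mulrA ug.
(* The equation u * g = w, solved for the coefficient of g multiplied by u(0). *)
pose F (g : nat -> k) i :=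
  (fps_coef u 0)^-1 *
    (fps_coef w i - \sum_(j < i) fps_coef u j.+1 * g (i - j.+1)%N).
have [d f g fg i|g Fg] := @contraction_fixpoint nat k id F (fun=> 0).
  rewrite ltnS => id; congr (_ * (_ - _)); apply: eq_bigr => j _.
  by rewrite fg //=; case: j => j /= ji; lia.
exists (Fps g); apply/fpsP => i; rewrite /= big_ord_recl /= subn0.
by rewrite -{1}(Fg i) /F mulrA divff // mul1r subrK.
Qed.

End FpsOrder.

(** * Linear maps with a subspace of finite codimension as kernel *)

(** Coordinates modulo U are linear because they are unique. Replacing U by the
    kernel of a linear map makes finite codimension easy to restrict to other
    spaces, by composing with a linear map into V. *)
Lemma dim_quotient_coords (k : fieldType) (V : lmodType k) (U : V -> Prop) d :
  (forall a u v, U u -> U v -> U (a *: u + v)) ->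
  dim_quotient U d ->
  exists (b : 'I_d -> V) (q : {linear V -> 'rV[k]_d}),
    (forall v, U v <-> q v = 0) /\ (forall v, q (v - \sum_i q v 0 i *: b i) = 0).
Proof.
move=> U_lin [b bP].
have U0 : U 0.
  have [c [Uc _]] := bP 0.
  by have := U_lin (-1) _ _ Uc Uc; rewrite scaleN1r addNr.
have UZ a u : U u -> U (a *: u) by move=> Uu; rewrite -[_ *: _]addr0; apply: U_lin.
have [c cP] := choice bP.
have c_uniq v (e : {ffun 'I_d -> k}) :
    U (v - \sum_i e i *: b i) -> e = c v.
  by move=> Ue; rewrite ((cP v).2 _ Ue).
pose q v := \row_i c v i.
have q_lin : linear q.
  move=> a u v; apply/rowP => i; rewrite !mxE.
  rewrite -(c_uniq _ [ffun i => a * c u i + c v i]) ?ffunE //.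
  have := U_lin a _ _ (cP u).1 (cP v).1.
  rewrite scalerBr addrACA scaler_sumr -opprD -big_split /=.
  by congr (U (_ - _)); apply: eq_bigr => j _; rewrite ffunE scalerDl scalerA.
pose qM := GRing.isLinear.Build _ _ _ _ q q_lin.
pose Q : {linear V -> 'rV[k]_d} := HB.pack q qM.
have QE v i : Q v 0 i = c v i by rewrite /= mxE.
have UQ v : U v <-> Q v = 0.
  split=> [Uv|Qv].
    apply/rowP => i; rewrite QE -(c_uniq v [ffun=> 0]) ?ffunE ?mxE //.
    by rewrite big1 ?subr0 // => j _; rewrite ffunE scale0r.
  have := (cP v).1; rewrite big1 ?subr0 // => j _.
  by rewrite -QE Qv mxE scale0r.
exists b, Q; split=> // v; apply/UQ.
by have := (cP v).1; congr (U (_ - _)); apply: eq_bigr => j _; rewrite QE.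
Qed.

Lemma linear_relation (k : fieldType) (V : lmodType k) d (q : {linear V -> 'rV[k]_d})
    N (v : 'I_N -> V) : (d < N)%N ->
  exists2 a : 'I_N -> k, (exists l, a l != 0) & q (\sum_l a l *: v l) = 0.
Proof.
move=> dN; pose M := \matrix_l q (v l).
have : kermx M != 0.
  by rewrite -mxrank_eq0 mxrank_ker subn_eq0 -ltnNge (leq_ltn_trans (rank_leq_col M)).
case/rowV0Pn => a /sub_kermxP aM /rV0Pn[l al].
exists (fun l => a 0 l); first by exists l.
by rewrite linear_sum -[RHS]aM mulmx_sum_row; apply: eq_bigr => i _; rewrite linearZ rowK.
Qed.

(** * Nonunital subalgebras of k[[t]] of finite codimension *)

(** Series of distinct orders: the term of least order among those with nonzero
    coefficient cannot cancel. *)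
Lemma order_witness (k : fieldType) N (a : 'I_N -> k) (f : 'I_N -> {fps k})
    (o : 'I_N -> nat) : injective o ->
  (forall l, fps_ord_ge (o l) (f l)) -> (forall l, fps_coef (f l) (o l) != 0) ->
  (exists l, a l != 0) ->
  exists l, [/\ a l != 0, fps_ord_ge (o l) (\sum_i a i *: f i) &
    fps_coef (\sum_i a i *: f i) (o l) != 0].
Proof.
move=> o_inj fo fo0 [l0 al0].
case: (@arg_minnP _ l0 (fun l => a l != 0) o al0) => l al min_l; exists l; split=> //.
  move=> i il; rewrite fps_coef_sum big1 // => j _ /=.
  have [->|aj] := eqVneq (a j) 0; first by rewrite mul0r.
  by rewrite fo ?mulr0 // (leq_trans il) ?min_l.
rewrite fps_coef_sum (bigD1 l) //= big1 ?addr0 ?mulf_neq0 // => j jl.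
have [->|aj] := eqVneq (a j) 0; first by rewrite mul0r.
rewrite fo ?mulr0 // ltn_neqAle min_l // andbT.
by apply: contra jl => /eqP /o_inj ->.
Qed.

Section Subalgebra.
Variables (k : fieldType) (d : nat) (q : {linear {fps k} -> 'rV[k]_d}).
Hypothesis qM : forall f g, q f = 0 -> q g = 0 -> q (f * g) = 0.

Let is_order s := exists f, [/\ q f = 0, fps_ord_ge s f & fps_coef f s != 0].

(** If there were more than d gaps g, some nontrivial combination of the t^g
    would lie in the kernel of q, and its order is one of the gaps. *)
Lemma card_gaps_le (s : nat) (G : {set 'I_s}) :
  (forall g, g \in G -> ~ is_order g) -> (#|G| <= d)%N.
Proof.
move=> gapG; rewrite leqNgt; apply/negP => dG.
pose o (l : 'I_#|G|) : nat := enum_val l.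
pose v (l : 'I_#|G|) : {fps k} := fpsX ^+ o l.
have [a a0 qa] := linear_relation q v dG.
have vE l i : fps_coef (v l) i = (i == o l)%:R.
  rewrite /v -[_ ^+ _]mulr1 fps_coefXnM /=.
  by case: ltngtP => [//|/subnSK <- //|->]; rewrite ?subnn.
have [l [_ ord_l coef_l]] : exists l, [/\ a l != 0,
    fps_ord_ge (o l) (\sum_i a i *: v i) & fps_coef (\sum_i a i *: v i) (o l) != 0].
  apply: order_witness => //.
  - by move=> l l' /val_inj /enum_val_inj.
  - by move=> l i il; rewrite vE ltn_eqF.
  - by move=> l; rewrite vE eqxx oner_eq0.
by apply: (gapG _ (enum_valP l)); exists (\sum_i a i *: v i).
Qed.

(** If s is a gap, the reflection a -> s - a sends orders to gaps, so at least
    half of the s + 1 numbers 0, ..., s are gaps. *)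
Lemma is_order_ge s : (d.*2 <= s)%N -> is_order s.
Proof.
move=> ds; apply: contrapT => gap_s.
pose G := [set a : 'I_s.+1 | ~~ `[< is_order a >]].
have Gd : (#|G| <= d)%N by apply: card_gaps_le => g; rewrite inE => /asboolP.
have : (#|~: G| <= #|G|)%N.
  rewrite -(card_imset _ rev_ord_inj); apply/subset_leq_card/subsetP => _ /imsetP[a aG ->].
  move: aG; rewrite !inE negbK => /asboolP[f [qf fa fa0]].
  apply/negP => /asboolP[g [qg gb gb0]]; apply: gap_s; exists (f * g).
  have e : s = (a + rev_ord a)%N by rewrite /= subSS subnKC // -ltnS.
  split; first exact: qM.
    by rewrite e; apply: fps_ord_geM.
  by rewrite e fps_coefM_lead // mulf_neq0.
have := cardsC G; rewrite card_ord; move: Gd ds; lia.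
Qed.

(** Downward induction from N: modulo t^(s+1) a series of order at least s is a
    multiple of a subalgebra element of order s. *)
Lemma conductor_le N (qN : forall w, q (fpsX ^+ N * w) = 0) s w :
  (d.*2 <= s)%N -> q (fpsX ^+ s * w) = 0.
Proof.
have [m] := ubnP (N - s); elim: m s w => // m IHm s w Nm ds.
have [Ns|sN] := leqP N s.
  by rewrite -(subnKC Ns) exprD -mulrA qN.
have [f [qf fs fs0]] := is_order_ge ds.
pose c := fps_coef w 0 / fps_coef f s.
have /fps_ord_geP[g fg] : fps_ord_ge s.+1 (fpsX ^+ s * w - c *: f).
  move=> i; rewrite ltnS leq_eqVlt => is_.
  have -> : fps_coef (fpsX ^+ s * w - c *: f) i =
    fps_coef (fpsX ^+ s * w) i - c * fps_coef f i by [].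
  rewrite fps_coefXnM; case/orP: is_ => [/eqP ->|is_].
    by rewrite ltnn subnn /c divfK ?subrr.
  by rewrite is_ fs // mulr0 subrr.
have -> : fpsX ^+ s * w = c *: f + (fpsX ^+ s * w - c *: f) by rewrite addrC subrK.
by rewrite linearP qf scaler0 add0r fg IHm //; lia.
Qed.

End Subalgebra.

(** * Orders of power series in several variables *)

Definition mps_ord_ge (k : fieldType) n (d : nat) (f : {mps k[n]}) : Prop :=
  forall m, (mdeg m < d)%N -> mps_coef f m = 0.

Section MpsOrder.
Variables (k : fieldType) (n : nat).
Implicit Types f g h : {mps k[n]}.

Lemma mps_coef_sum I (s : seq I) (P : pred I) (F : I -> {mps k[n]}) m :
  mps_coef (\sum_(l <- s | P l) F l) m = \sum_(l <- s | P l) mps_coef (F l) m.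
Proof. by apply: (big_morph (fun f => mps_coef f m)). Qed.

Lemma mps_ord_geD d f g : mps_ord_ge d f -> mps_ord_ge d g -> mps_ord_ge d (f + g).
Proof. by move=> fd gd m md /=; rewrite fd // gd // addr0. Qed.

Lemma mps_ord_ge_sum d I (s : seq I) (P : pred I) (F : I -> {mps k[n]}) :
  (forall l, P l -> mps_ord_ge d (F l)) -> mps_ord_ge d (\sum_(l <- s | P l) F l).
Proof.
by move=> Fd m md; rewrite mps_coef_sum big1 // => l Pl; apply: Fd.
Qed.

Lemma mps_ord_geM a b f g :
  mps_ord_ge a f -> mps_ord_ge b g -> mps_ord_ge (a + b) (f * g).
Proof.
move=> fa gb m mab /=; apply: big1 => -[h1 h2] /= /eqP mE.
have {}mab : (mdeg h1 + mdeg h2 < a + b)%N by rewrite -mdegD -mE.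
case: (ltnP (mdeg h1) a) => ha; first by rewrite fa ?mul0r.
by rewrite gb ?mulr0 //; lia.
Qed.

Lemma mps_ord_geM0 d f g : mps_ord_ge d g -> mps_ord_ge d (f * g).
Proof. exact: (@mps_ord_geM 0). Qed.

Lemma mps_ord_geX i : mps_ord_ge 1 (mpsX i : {mps k[n]}).
Proof.
move=> m; rewrite ltnS leqn0 mdeg_eq0 => /eqP -> /=.
by rewrite eq_sym -mdeg_eq0 mdeg1.
Qed.

Lemma mps_coefXM i g m :
  mps_coef (mpsX i * g) m = if (0 < m i)%N then mps_coef g (m - U_(i))%MM else 0.
Proof.
rewrite /=; case: ifP => [mi|/negbT mi]; last first.
  apply: big1 => -[h1 h2] /= /eqP mE; case: eqP => [e|]; last by rewrite mul0r.
  by case/negP: mi; rewrite mE mnmDE e mnm1E eqxx.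
have mE : m = (U_(i) + (m - U_(i)))%MM.
  by rewrite addmC submK // lep1mP -lt0n.
have Ub : (mdeg U_(i)%MM < (mdeg m).+1)%N by rewrite [in X in (_ < X)%N]mE mdegD; lia.
have mUb : (mdeg (m - U_(i))%MM < (mdeg m).+1)%N by rewrite ltnS mdegB.
rewrite (bigD1 (BMultinom Ub, BMultinom mUb)) /=; last by rewrite -mE.
rewrite eqxx mul1r big1 ?addr0 // => -[h1 h2] /= /andP[/eqP e ne].
case: eqP => [e1|]; last by rewrite mul0r.
case/eqP: ne; congr (_, _); apply: val_inj => //=.
by apply: (@addmI _ U_(i)%MM); rewrite -mE -e1 -e.
Qed.

(** Every monomial of positive degree is divided by the first variable that
    occurs in it; g_i collects the quotients by x_i. Most facts below about
    morphisms out of P follow by induction along this decomposition. *)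
Lemma hadamard f : exists g : 'I_n -> {mps k[n]},
  f = mps_coef f 0%MM *: 1 + \sum_i mpsX i * g i /\
  forall d, mps_ord_ge d.+1 f -> forall i, mps_ord_ge d (g i).
Proof.
pose first (i : 'I_n) (m : 'X_{1..n}) := [forall j : 'I_n, (j < i)%N ==> (m j == 0%N)].
exists (fun i => Mps (fun m => if first i m then mps_coef f (m + U_(i))%MM else 0)).
split=> [|d fd i m md /=]; last first.
  by case: ifP => // _; rewrite fd // mdegD mdeg1 addn1.
apply/mpsP => m.
have -> (a : k) (s : {mps k[n]}) : mps_coef (a *: 1 + s) m =
    a * (m == 0%MM)%:R + mps_coef s m by [].
rewrite mps_coef_sum; under eq_bigr do rewrite mps_coefXM /=.
have [->|m0] := eqVneq m 0%MM.
  by rewrite mulr1 big1 ?addr0 // => i _; rewrite mnm0E.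
rewrite mulr0 add0r.
have [i mi] : exists i, (0 < m i)%N.
  apply: contrapT => nm; case/eqP: m0; apply/mnmP => i; rewrite mnm0E.
  by apply: contrapT => mi; apply: nm; exists i; rewrite lt0n; apply/eqP.
case: (@arg_minnP _ i (fun i => 0 < m i)%N val mi) => i0 mi0 min_i0.
have subE : (m - U_(i0) + U_(i0))%MM = m by rewrite submK // lep1mP -lt0n.
rewrite (bigD1 i0) //= mi0 subE big1 ?addr0 => [|j ji0].
  rewrite ifT //; apply/forallP => j; apply/implyP => ji0.
  rewrite mnmBE mnm1E; case: (i0 =P j) => [e|_]; first by rewrite e ltnn in ji0.
  by rewrite subn0; apply: contraTT ji0; rewrite -lt0n -leqNgt; apply: min_i0.
case: ifP => // mj; case: ifP => // /forallP/(_ i0).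
rewrite ltn_neqAle min_i0 // andbT; case: eqVneq => [/val_inj e|_] /=.
  by rewrite e eqxx in ji0.
by rewrite mnmBE mnm1E (negbTE ji0) subn0 eqn0Ngt mi0.
Qed.

(** * Morphisms of power series algebras *)

Lemma lrmorphism_hadamard (B : algType k) (al : {lrmorphism {mps k[n]} -> B}) c
    (g : 'I_n -> {mps k[n]}) :
  al (c *: 1 + \sum_i mpsX i * g i) = c *: 1 + \sum_i al (mpsX i) * al (g i).
Proof.
rewrite linearD linearZ rmorph1 linear_sum; congr (_ + _).
by apply: eq_bigr => i _; rewrite rmorphM.
Qed.

(** Such morphisms are automatically continuous: by the decomposition above, if
    their values on all series agree modulo t^d, they agree modulo t^(d+1), since
    the variables have images of positive order. *)
Lemma lrmorphism_ext (al be : {lrmorphism {mps k[n]} -> {fps k}}) :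
  (forall i, al (mpsX i) = be (mpsX i)) -> (forall i, fps_ord_ge 1 (al (mpsX i))) ->
  al =1 be.
Proof.
move=> eqX al1.
have close d : forall f, fps_ord_ge d (al f - be f).
  elim: d => [//|d IHd] f; have [g [-> _]] := hadamard f.
  rewrite !lrmorphism_hadamard opprD addrACA subrr add0r -sumrB.
  apply: fps_ord_ge_sum => i _; rewrite -eqX -mulrBr.
  exact: (fps_ord_geM (al1 i)).
move=> f; apply/fpsP => i; apply/eqP; rewrite -subr_eq0; apply/eqP.
exact: (close i.+1 f i).
Qed.

Lemma lrmorphism_mod_const (al : {lrmorphism {mps k[n]} -> {fps k}}) e f :
  (forall i, fps_ord_ge e (al (mpsX i))) ->
  fps_ord_ge e (al f - mps_coef f 0%MM *: 1).
Proof.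
move=> ale; have [g [fE _]] := hadamard f.
rewrite {1}fE lrmorphism_hadamard addrC addKr.
apply: fps_ord_ge_sum => i _; rewrite -[e]addn0; exact: fps_ord_geM.
Qed.

(** On the term x_i g of the decomposition, s(x_i g) - x_i g is
    (s(x_i) - x_i) s(g) + x_i (s(g) - g), and both summands gain an order. *)
Lemma perturbation_ord (s : {lrmorphism {mps k[n]} -> {mps k[n]}}) :
  (forall i, mps_ord_ge 2 (s (mpsX i) - mpsX i)) ->
  forall d f, mps_ord_ge d f -> mps_ord_ge d.+1 (s f - f).
Proof.
move=> s2; elim=> [|d IHd] f fd; have [g [fE gd]] := hadamard f;
  rewrite fE lrmorphism_hadamard opprD addrACA subrr add0r -sumrB;
  apply: mps_ord_ge_sum => i _;
  rewrite -[s (mpsX i)](subrK (mpsX i)) mulrDl -addrA -mulrBr; apply: mps_ord_geD.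
- by move=> m m1; apply: (@mps_ord_geM 2 0 _ _ (s2 i)) => //; lia.
- exact: (@mps_ord_geM 1 0 _ _ (mps_ord_geX i)).
- have gi := IHd _ (gd d fd i); apply: (mps_ord_geM (s2 i)); rewrite -[s _](subrK (g i)).
  apply: mps_ord_geD; last exact: gd.
  by move=> m md; apply: gi; lia.
- exact: (mps_ord_geM (mps_ord_geX i) (IHd _ (gd d fd i))).
Qed.

End MpsOrder.

Lemma lrmorphism_of (k : fieldType) (A B : algType k) (f : A -> B) :
  linear f -> monoid_morphism f -> exists F : {lrmorphism A -> B}, F =1 f.
Proof.
move=> fL fM.
pose mL := GRing.isLinear.Build _ _ _ _ f fL.
pose mM := GRing.isMonoidMorphism.Build _ _ f fM.
pose F : {lrmorphism A -> B} := HB.pack f mL mM.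
by exists F.
Qed.

(** As s - id raises orders, it contracts: s(f) = g is solved by iterating
    f -> g - (s(f) - f), and a nonzero f cannot have s(f) = 0. *)
Lemma perturbation_inverse (k : fieldType) n (s : {lrmorphism {mps k[n]} -> {mps k[n]}}) :
  (forall i, mps_ord_ge 2 (s (mpsX i) - mpsX i)) ->
  exists sV : {lrmorphism {mps k[n]} -> {mps k[n]}}, cancel s sV /\ cancel sV s.
Proof.
move=> s2; have s_ord := perturbation_ord s2.
have s_surj g : exists f, s f = g.
  pose F (f : 'X_{1..n} -> k) := mps_coef (g - (s (Mps f) - Mps f)).
  have [d f f' ff' m md|f Ff] :=
    @contraction_fixpoint _ k (fun m : 'X_{1..n} => mdeg m) F (fun=> 0).
    have : mps_ord_ge d (Mps f - Mps f') by move=> m' m'd /=; rewrite ff' ?subrr.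
    move=> /s_ord/(_ m md) /=; rewrite linearB /= => e.
    apply/eqP; rewrite -subr_eq0 -oppr_eq0 -[X in _ == X]e /F /=; apply/eqP; ring.
  exists (Mps f); apply/mpsP => m; have := Ff m; rewrite /F /= => e.
  apply: (addIr (f m - mps_coef (s (Mps f)) m)); rewrite addrCA subrr addr0 -{1}e.
  by ring.
have s_inj : injective s.
  suff s0 f : s f = 0 -> f = 0.
    by move=> f f' e; apply/eqP; rewrite -subr_eq0; apply/eqP/s0; rewrite linearB /= e subrr.
  move=> sf; have f_ord d : mps_ord_ge d f.
    elim: d => [//|d IHd] m md.
    by have := s_ord _ _ IHd m md; rewrite sf /= add0r => /eqP; rewrite oppr_eq0 => /eqP.
  by apply/mpsP => m; apply: (f_ord (mdeg m).+1).
have [t st] := choice s_surj.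
have ts : cancel s t by move=> f; apply: s_inj; rewrite st.
have lin : linear t by move=> a u v; apply: s_inj; rewrite [LHS]st linearP /= !st.
have mul : monoid_morphism t.
  split=> [|u v]; apply: s_inj; first by rewrite st rmorph1.
  by rewrite [LHS]st rmorphM /= !st.
have [sV sVE] := lrmorphism_of lin mul.
by exists sV; split=> f; rewrite sVE.
Qed.

(** * Substitution *)

Section Substitution.
Variables (k : fieldType) (n : nat) (h : 'I_n -> {mps k[n]}).
Hypothesis h1 : forall i, mps_ord_ge 1 (h i).

Let ev (p : {mpoly k[n]}) : {mps k[n]} := mmap (in_alg {mps k[n]}) h p.

Definition mps_trunc d (f : {mps k[n]}) : {mpoly k[n]} :=
  \sum_(m : 'X_{1..n < d}) mps_coef f m *: 'X_[m].

Definition mps_of_mpoly (p : {mpoly k[n]}) : {mps k[n]} := Mps (fun m => p@_m).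

Lemma mps_truncK d f : mps_ord_ge d (f - mps_of_mpoly (mps_trunc d f)).
Proof.
move=> m md; rewrite /= /mps_trunc raddf_sum /= (bigD1 (BMultinom md)) //=.
rewrite mcoeffZ mcoeffX eqxx mulr1 big1 ?addr0 ?subrr // => m' ne.
rewrite mcoeffZ mcoeffX; case: eqP => [e|_]; last by rewrite mulr0.
by case/eqP: ne; apply: val_inj.
Qed.

Lemma mmap_ord d p : (forall m, (mdeg m < d)%N -> p@_m = 0) -> mps_ord_ge d (ev p).
Proof.
move=> pd; rewrite /ev /mmap; apply: mps_ord_ge_sum => m _.
have [/pd ->|dm] := ltnP (mdeg m) d; first by rewrite rmorph0 mul0r.
apply: mps_ord_geM0 => m' m'd.
have prod_ord (r : seq 'I_n) :
    mps_ord_ge (\sum_(i <- r) m i) (\prod_(i <- r) h i ^+ m i).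
  elim: r => [|i r IHr]; first by rewrite !big_nil.
  rewrite !big_cons; apply: mps_ord_geM => //.
  elim: (m i) => [//|e IHe]; rewrite exprS; exact: (@mps_ord_geM _ _ 1 e).
by apply: prod_ord; rewrite -mdegE; lia.
Qed.

(** Since the h i have positive order, the coefficient at m of the substituted
    series depends only on the monomials of f of degree at most that of m, so it
    can be read off the evaluation of a polynomial. *)
Definition mps_subst (f : {mps k[n]}) : {mps k[n]} :=
  Mps (fun m => mps_coef (ev (mps_trunc (mdeg m).+1 f)) m).

(** The truncation used to define a coefficient is immaterial. The algebraic
    properties of the substitution are thereby inherited from the evaluation of
    polynomials. *)
Lemma mps_subst_approx d f p : mps_ord_ge d (f - mps_of_mpoly p) ->
  mps_ord_ge d (mps_subst f - ev p).
Proof.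
move=> fp m md.
have -> : mps_coef (mps_subst f - ev p) m =
  mps_coef (ev (mps_trunc (mdeg m).+1 f - p)) m by rewrite /ev mmapB.
apply: (@mmap_ord (mdeg m).+1) => // m' m'd.
have := fp m' (leq_trans m'd md); have := @mps_truncK (mdeg m).+1 f m' m'd.
by rewrite mcoeffB /= => /subr0_eq <- /subr0_eq ->; rewrite subrr.
Qed.

Lemma mps_eq_all_ord f g : (forall d, mps_ord_ge d (f - g)) -> f = g :> {mps k[n]}.
Proof.
move=> fg; apply/mpsP => m; apply/eqP; rewrite -subr_eq0; apply/eqP.
exact: (fg (mdeg m).+1).
Qed.

Lemma substitution_morphism : exists s : {lrmorphism {mps k[n]} -> {mps k[n]}},
  forall i, s (mpsX i) = h i.
Proof.
have lin : linear mps_subst.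
  move=> a f g; apply: mps_eq_all_ord => d.
  have fp := @mps_truncK d f; have gq := @mps_truncK d g.
  set p := mps_trunc d f in fp; set q := mps_trunc d g in gq.
  have apq : mps_ord_ge d (a *: f + g - mps_of_mpoly (a *: p + q)).
    move=> m md; have := fp m md; have := gq m md.
    by rewrite /= mcoeffD mcoeffZ => /subr0_eq -> /subr0_eq ->; rewrite subrr.
  have evE : ev (a *: p + q) = a *: ev p + ev q.
    by rewrite /ev mmapD mmapZ; congr (_ + _); apply: mulr_algl.
  move=> m md; have := mps_subst_approx apq md; rewrite evE.
  have := mps_subst_approx fp md; have := mps_subst_approx gq md.
  by rewrite /= => /subr0_eq -> /subr0_eq -> /subr0_eq ->; rewrite subrr.
have mul : monoid_morphism mps_subst.
  split=> [|f g]; apply: mps_eq_all_ord => d.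
    rewrite [X in _ - X](_ : 1 = ev 1); last by rewrite /ev rmorph1.
    apply: mps_subst_approx => m _ /=.
    by rewrite mcoeff1 subrr.
  have fp := @mps_truncK d f; have gq := @mps_truncK d g.
  set p := mps_trunc d f in fp; set q := mps_trunc d g in gq.
  have pqE : mps_of_mpoly (p * q) = mps_of_mpoly p * mps_of_mpoly q.
    by apply/mpsP => m /=; rewrite mcoeffM.
  have close (u v u' v' : {mps k[n]}) :
    mps_ord_ge d (u - u') -> mps_ord_ge d (v - v') -> mps_ord_ge d (u * v - u' * v').
    move=> uu' vv'; have -> : u * v - u' * v' = v * (u - u') + u' * (v - v') by ring.
    by apply: mps_ord_geD; apply: mps_ord_geM0.
  have : mps_ord_ge d (f * g - mps_of_mpoly (p * q)) by rewrite pqE; apply: close.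
  move=> /mps_subst_approx; rewrite {1}/ev rmorphM /= => fgpq.
  have := close _ _ _ _ (mps_subst_approx fp) (mps_subst_approx gq).
  move=> fgpq' m md; have := fgpq m md; have := fgpq' m md.
  by rewrite /= => /subr0_eq -> /subr0_eq ->; rewrite subrr.
have [s sE] := lrmorphism_of lin mul.
exists s => i; rewrite sE; apply: mps_eq_all_ord => d.
have -> : h i = ev 'X_i by rewrite /ev mmapX mmap1U.
by apply: mps_subst_approx => m _ /=; rewrite mcoeffX eq_sym subrr.
Qed.

End Substitution.

(** * The product of the branches *)

Definition on_branch (k : fieldType) r (j : 'I_r) (f : {fps k}) : Rtilde k r :=
  [ffun l => if l == j then f else 0].

Section Branches.
Variables (k : fieldType) (r : nat).
Implicit Types (f g : {fps k}) (u v : Rtilde k r).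

Lemma on_branch_linear (j : 'I_r) : linear (@on_branch k r j).
Proof.
move=> a f g; apply/ffunP => l; rewrite !ffunE.
by case: eqP => // _; rewrite scaler0 addr0.
Qed.

HB.instance Definition _ j := GRing.isLinear.Build _ _ _ _ _ (on_branch_linear j).

Lemma on_branchM (j : 'I_r) f v : on_branch j (v j * f) = v * on_branch j f.
Proof. by apply/ffunP => l; rewrite !ffunE; case: eqP => [->|]; rewrite ?mulr0. Qed.

Lemma sum_on_branch v : v = \sum_j on_branch j (v j).
Proof.
apply/ffunP => l; rewrite sum_ffunE (bigD1 l) //= ffunE eqxx big1 ?addr0 // => j jl.
by rewrite ffunE eq_sym (negbTE jl).
Qed.

Lemma ffun_scalerAl c u v : c *: (u * v) = (c *: u) * v.
Proof. by apply/ffunP => l; rewrite !ffunE scalerAl. Qed.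

Lemma ffun_scalerAr c u v : c *: (u * v) = u * (c *: v).
Proof. by apply/ffunP => l; rewrite !ffunE scalerAr. Qed.

Lemma ffun_prodE s (g : 'I_s -> Rtilde k r) j : (\prod_i g i) j = \prod_i g i j.
Proof. by apply: (big_morph (fun v => v j)) => [u v|]; rewrite ffunE. Qed.

Lemma mtildeP v : mtilde v <-> forall j, fps_ord_ge 1 (v j).
Proof.
split=> v1 j; first by apply/fps_ord_geP; rewrite expr1; apply: v1.
by have /fps_ord_geP := v1 j; rewrite expr1.
Qed.

Lemma ideal_pow_mtilde s v : ideal_pow (@mtilde k r) s v -> forall j, fps_ord_ge s (v j).
Proof.
case=> N [c [g [g1 ->]]] j; rewrite sum_ffunE; apply: fps_ord_ge_sum => l _.
rewrite ffunE ffun_prodE; apply: (@fps_ord_geM _ 0) => //.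
by apply: fps_ord_ge_prod => i; have /mtildeP := g1 l i.
Qed.

Lemma branch_morphism n (phi : {lrmorphism {mps k[n]} -> Rtilde k r}) j :
  exists al : {lrmorphism {mps k[n]} -> {fps k}}, forall p, al p = phi p j.
Proof.
apply: lrmorphism_of => [a f g|]; first by rewrite linearP !ffunE.
by split=> [|f g]; rewrite ?rmorph1 ?rmorphM ffunE.
Qed.

End Branches.

(** * Conductor and multiplicity of a parameterization of finite delta *)

Section FiniteDelta.
Variables (k : fieldType) (n r : nat) (phi : {lrmorphism {mps k[n]} -> Rtilde k r}).
Hypothesis phi_param : parameterization phi.
Variable d : nat.
Variables (b : 'I_d -> Rtilde k r) (q : {linear Rtilde k r -> 'rV[k]_d}).
Hypothesis qP : forall v, (exists f, phi f = v) <-> q v = 0.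
Hypothesis qb : forall v, q (v - \sum_i q v 0 i *: b i) = 0.

Lemma phi_ord_ge1 i j : fps_ord_ge 1 (phi (mpsX i) j).
Proof. by have [phi1 _ _] := phi_param; have /mtildeP := phi1 i. Qed.

Lemma im_mul u v : q u = 0 -> q v = 0 -> q (u * v) = 0.
Proof. by move=> /qP[f <-] /qP[g <-]; apply/qP; exists (f * g); rewrite rmorphM. Qed.

(** Let x be the image of a variable with x_j nonzero. Among d^2 + 1 powers of x
    some combination f has f b_l in R for the d representatives b_l of a basis
    of the quotient by R. Then f multiplies the whole product into R. Its j-th
    component is nonzero because the powers of x_j have distinct orders. *)
Lemma conductor_ex (j : 'I_r) : exists N, forall w, q (on_branch j (fpsX ^+ N * w)) = 0.
Proof.
have [_ phi0 _] := phi_param; have [i /fps_ord_ex[a ya ya0]] := phi0 j.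
set x := phi (mpsX i) in ya ya0.
have a_gt0 : (0 < a)%N.
  by rewrite lt0n; apply: contra ya0 => /eqP ->; apply/eqP; apply: phi_ord_ge1.
pose Q v := mxvec (\matrix_l q (v * b l)) : 'rV[k]_(d * d).
have Qlin : linear Q.
  move=> c u v; rewrite /Q -linearP; congr mxvec; apply/matrixP => l m; rewrite !mxE.
  by rewrite mulrDl -ffun_scalerAl linearP !mxE.
pose Q_ : {linear Rtilde k r -> 'rV[k]_(d * d)} :=
  HB.pack Q (GRing.isLinear.Build _ _ _ _ Q Qlin).
have [c c0 Qc] := linear_relation Q_ (fun l : 'I_(d * d).+1 => x ^+ l.+1) (ltnSn _).
set f := \sum_l _ in Qc.
have qf : q f = 0.
  apply/qP; exists (\sum_l c l *: mpsX i ^+ l.+1).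
  by rewrite linear_sum; apply: eq_bigr => l _; rewrite linearZ rmorphXn.
have qfb l : q (f * b l) = 0.
  move: Qc => /= /(congr1 vec_mx); rewrite mxvecK linear0 => /matrixP Qc.
  by apply/rowP => m; have := Qc l m; rewrite !mxE.
have qfv v : q (f * v) = 0.
  rewrite -[v](subrK (\sum_i q v 0 i *: b i)) mulrDr linearD im_mul ?qb // add0r.
  by rewrite mulr_sumr linear_sum big1 // => l _; rewrite -ffun_scalerAr linearZ /= qfb scaler0.
have xE l : (x ^+ l) j = x j ^+ l.
  by elim: l => [|l IHl]; rewrite ?expr0 ?exprS ffunE ?IHl.
have fjE : f j = \sum_l c l *: x j ^+ l.+1.
  by rewrite sum_ffunE; apply: eq_bigr => l _; rewrite ffunE xE.
have ordX l : fps_ord_ge (a * l) (x j ^+ l) /\ fps_coef (x j ^+ l) (a * l) != 0.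
  elim: l => [|l [IHl IHl0]]; first by rewrite muln0 expr0 /= oner_eq0.
  rewrite mulnS exprS; split; first exact: fps_ord_geM.
  by rewrite fps_coefM_lead ?mulf_neq0.
have [l [_ fj fj0]] : exists l, [/\ c l != 0,
    fps_ord_ge (a * l.+1) (f j) & fps_coef (f j) (a * l.+1) != 0].
  rewrite fjE; apply: (order_witness (o := fun l : 'I__ => (a * l.+1)%N)) => //.
  - move=> l l' /eqP; rewrite eqn_pmul2l // => /eqP[e]; exact: val_inj.
  - by move=> l; have [] := ordX l.+1.
  - by move=> l; have [] := ordX l.+1.
exists (a * l.+1)%N => w; have [g <-] := fps_divX w fj fj0.
by rewrite on_branchM qfv.
Qed.

(** The series whose copy on branch j lies in R form a nonunital subalgebra of
    codimension at most d. *)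
Lemma conductor_2delta (j : 'I_r) s w : (d.*2 <= s)%N ->
  q (on_branch j (fpsX ^+ s * w)) = 0.
Proof.
have [N qN] := conductor_ex j.
apply: (@conductor_le _ _ (q \o on_branch j) _ N qN) => f g /= qf qg.
have -> : f * g = on_branch j f j * g by rewrite ffunE eqxx.
by rewrite on_branchM im_mul.
Qed.

(** If all variables had order at least E on branch j, each element of R would
    have a j-th component constant modulo t^E; with a second branch, on which
    a tuple from branch j vanishes, that constant is 0. So the t^m on branch j with
    m < E, or 0 < m < E for a single branch, would be independent modulo R. *)
Lemma small_order (nondeg : (1 < r)%N || (1 < d)%N) (j : 'I_r) :
  exists i e, [/\ (0 < e)%N, (e < d.*2)%N, fps_ord_ge e (phi (mpsX i) j) &
    fps_coef (phi (mpsX i) j) e != 0].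
Proof.
(* No order is below d.*2 when d = 0; with E at least 1 the argument also
   refutes d = 0. *)
pose E := maxn d.*2 1.
suff [i niE] : exists i, ~ fps_ord_ge E (phi (mpsX i) j).
  have /fps_ord_ex[e ord_e e0] : phi (mpsX i) j != 0 by apply: contra_notN niE => /eqP ->.
  have e_gt0 : (0 < e)%N.
    by rewrite lt0n; apply: contra e0 => /eqP ->; apply/eqP; apply: phi_ord_ge1.
  exists i, e; split=> //; have : (e < E)%N.
    by rewrite ltnNge; apply: contra_notN niE => Ee m mE; apply: ord_e; lia.
  by rewrite /E; lia.
apply: contrapT => niE.
have ordE i : fps_ord_ge E (phi (mpsX i) j).
  by apply: contrapT => niEi; apply: niE; exists i.
(* The least exponent used: t^0 on the branch is independent modulo R only in
   the presence of a second branch. *)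
pose c0 := (r <= 1)%N : nat.
have dN : (d < E - c0)%N by move: nondeg; rewrite /E /c0; lia.
pose v (l : 'I_(E - c0)) : {fps k} := fpsX ^+ (l + c0).
have [a a0 qa] := linear_relation (q \o on_branch j) v dN.
have vE l i : fps_coef (v l) i = (i == l + c0)%N%:R.
  rewrite /v -[_ ^+ _]mulr1 fps_coefXnM /=.
  by case: ltngtP => [//|/subnSK <- //|->]; rewrite ?subnn.
set p := \sum_l _ in qa.
have [l [_ _ pl]] : exists l, [/\ a l != 0, fps_ord_ge (l + c0) p & fps_coef p (l + c0) != 0].
  apply: (order_witness (o := fun l : 'I__ => (l + c0)%N)) => //.
  - by move=> l l' /addIn /val_inj.
  - by move=> l i il; rewrite vE ltn_eqF.
  - by move=> l; rewrite vE eqxx oner_eq0.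
have [f fE] := (qP _).2 qa.
have const j' E' m : (forall i, fps_ord_ge E' (phi (mpsX i) j')) -> (m < E')%N ->
    fps_coef (on_branch j p j') m = mps_coef f 0%MM * (m == 0%N)%:R.
  move=> ordE' mE'; have [al alE] := branch_morphism phi j'.
  have alX i : fps_ord_ge E' (al (mpsX i)) by rewrite alE.
  have := lrmorphism_mod_const f alX mE'.
  by rewrite alE fE /= => /subr0_eq.
have lE : (l + c0 < E)%N by have := ltn_ord l; lia.
case/eqP: pl; have := const j E _ ordE lE; rewrite ffunE eqxx => ->.
have [l0|_] := eqVneq; last by rewrite mulr0.
have r_gt1 : (1 < r)%N by move: l0; rewrite /c0; lia.
have [j' jj'] : exists j' : 'I_r, j' != j.
  pose z := Ordinal (ltnW r_gt1); pose o := Ordinal r_gt1.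
  by have [jz|jz] := eqVneq j z; [exists o; rewrite jz|exists z; rewrite eq_sym].
have := const j' 1%N 0%N (fun i => @phi_ord_ge1 i j') isT.
by rewrite ffunE (negbTE jj') /= => <-.
Qed.

(** With e < 2d the order of phi(x_i) on branch j, one has
    4d - 1 = 2d + e + (2d - 1 - e), so phi(x_i) can be divided out leaving order
    at least 2d, inside the conductor. The quotient lifts to a series without
    constant term, which makes its product with x_i of order at least 2. *)
Lemma lift_order_2 (nondeg : (1 < r)%N || (1 < d)%N) (v : Rtilde k r) :
  (forall j, fps_ord_ge (4 * d - 2).+1 (v j)) ->
  exists2 g, mps_ord_ge 2 g & phi g = v.
Proof.
move=> v_ord.
have lift j : exists g, mps_ord_ge 2 g /\ phi g = on_branch j (v j).
  have [i [e [e_gt0 ed ye ye0]]] := small_order nondeg j.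
  have /fps_ord_geP[w ->] := v_ord j.
  have [g yg] := fps_divX (fpsX ^+ (d.*2 - e).-1 * w) ye ye0.
  have [p pE] := (qP _).2 (@conductor_2delta j _ g (leqnn _)).
  have -> : fpsX ^+ (4 * d - 2).+1 * w = phi (mpsX i) j * (fpsX ^+ d.*2 * g).
    rewrite mulrCA yg !mulrA -!exprD; congr (_ ^+ _ * _); lia.
  exists (mpsX i * p); split; last by rewrite rmorphM /= pE on_branchM.
  apply: (mps_ord_geM (@mps_ord_geX _ _ i)) => m.
  rewrite ltnS leqn0 mdeg_eq0 => /eqP ->.
  have [al alE] := branch_morphism phi j.
  have al1 i' : fps_ord_ge 1 (al (mpsX i')) by rewrite alE; apply: phi_ord_ge1.
  have := lrmorphism_mod_const p al1 (ltnSn 0); rewrite alE pE ffunE eqxx.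
  move=> /subr0_eq; rewrite fps_coefXnM (_ : (0 < d.*2)%N); last by lia.
  by rewrite /= mulr1 => <-.
have [g gP] := choice lift.
exists (\sum_j g j); first by apply: mps_ord_ge_sum => j _; have [] := gP j.
by rewrite [RHS]sum_on_branch linear_sum; apply: eq_bigr => j _; have [] := gP j.
Qed.

End FiniteDelta.

(** * Determinacy *)

Theorem corollary12 (k : fieldType) (n r : nat)
    (phi : {lrmorphism {mps k[n]} -> Rtilde k r})
    (phi_param : parameterization phi)
    (delta : nat) (phi_delta : delta_invariant phi delta)
    (* Needed: the conclusion fails whenever r = 1 and delta <= 1. For example,
       (t^2, t^3) and (t^2, t^5) agree modulo t^3, and t and t^2 modulo t. *)
    (nondeg : (1 < r)%N || (1 < delta)%N) :
  L_determined (4 * delta - 2)%N phi.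
Proof.
move=> psi psi_param close.
have [|b [q [qP qb]]] := dim_quotient_coords _ phi_delta.
  by move=> a _ _ [f <-] [g <-]; exists (a *: f + g); rewrite linearP.
have lift i : exists g, mps_ord_ge 2 g /\ phi g = psi (mpsX i) - phi (mpsX i).
  have v_ord j : fps_ord_ge (4 * delta - 2).+1 ((psi (mpsX i) - phi (mpsX i)) j).
    move=> m md; have := @ideal_pow_mtilde _ _ _ _ (close i) j m md.
    by rewrite !ffunE /= => /subr0_eq ->; rewrite subrr.
  by have [g g2 gE] := lift_order_2 phi_param qP qb nondeg v_ord; exists g.
have [g gP] := choice lift.
have [|s sX] := @substitution_morphism k n (fun i => mpsX i + g i).
  move=> i; apply: mps_ord_geD; first exact: mps_ord_geX.
  by move=> m m1; apply: (gP i).1; lia.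
have [|sV [sK sVK]] := @perturbation_inverse _ _ s.
  by move=> i; rewrite sX addrC addKr; apply: (gP i).1.
exists sV, s; split=> // f; apply/ffunP => j.
have [al alE] := branch_morphism phi j; have [be beE] := branch_morphism psi j.
have sXE i : al (s (mpsX i)) = be (mpsX i).
  by rewrite alE beE sX linearD /= (gP i).2 addrC subrK.
rewrite /= -alE -beE; apply: (@lrmorphism_ext _ _ (al \o s) be) => //= i.
rewrite sXE beE; have [psi1 _ _] := psi_param.
by have /mtildeP := psi1 i.
Qed.
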